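(* For every integer $s \geq 0$, $$\mathrm{ML}(8,\,4s+3,\,4s+11,\,4s+19) = \frac{2s+7}{8s+30} = \frac{2s+7}{4(2s+7)+2}.$$
   Context: For real $x$, $\|x\|$ denotes the distance from $x$ to the nearest integer. For positive integers $v_1,\ldots,v_n$, the maximum loneliness is $\mathrm{ML}(v_1,\ldots,v_n) = \max_{t\in\mathbb{R}} \min_{1\le i\le n} \|t v_i\|$. *)

(* Defs.v *)
From HB Require Import structures.
From mathcomp Require Export all_boot all_order all_algebra.
From mathcomp Require Export boolp classical_sets reals.
Set Implicit Arguments.
Unset Strict Implicit.
Unset Printing Implicit Defensive.
Import Order.TTheory GRing.Theory Num.Theory.
Local Open Scope classical_set_scope.
Local Open Scope ring_scope.

(* The infimum is attained, see [distZE]. *)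
Definition distZ (R : realType) (x : R) : R :=
  inf [set `|x - k%:~R| | k in [set: int]].

(* The greatest element of A, with the junk value 0 if A has none: for c != 0,
   [maximum A = c] says that the maximum exists and is c, see [maximum_eqP]. *)
Definition maximum (R : realType) (A : set R) : R := xget 0 (A `&` ubound A).

(* The neutral element of the iterated minimum is one of its terms, so this is
   the minimum of the n.+1 distances. *)
Definition min_distZ (R : realType) (n : nat) (v : n.+1.-tuple nat) (t : R) : R :=
  \big[Num.min/distZ (t * (thead v)%:R)]_(i < n.+1) distZ (t * (tnth v i)%:R).

Definition ML (R : realType) (n : nat) (v : n.+1.-tuple nat) : R :=
  maximum [set min_distZ v t | t in [set: R]].

Lemma distZE (R : realType) (x : R) :
  distZ x = Num.min (x - (Num.floor x)%:~R) ((Num.floor x + 1)%:~R - x).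
Proof.
have [lef ltf] : (Num.floor x)%:~R <= x /\ x < (Num.floor x + 1)%:~R.
  by split; [exact: floor_le | exact: floorD1_gt].
set m := Num.min _ _.
have lbm : lbound [set `|x - k%:~R| | k in [set: int]] m.
  move=> _ [k _ <-]; rewrite ge_min; have [kf|fk] := leP k (Num.floor x).
    apply/orP; left; apply: le_trans (ler_norm _).
    by rewrite lerD2l lerN2 ler_int.
  apply/orP; right; rewrite distrC; apply: le_trans (ler_norm _).
  by rewrite lerD2r ler_int lezD1.
have Am : [set `|x - k%:~R| | k in [set: int]] m.
  rewrite /m minEle; case: ifP => _.
    by exists (Num.floor x) => //; rewrite ger0_norm // subr_ge0.
  by exists (Num.floor x + 1) => //; rewrite distrC gtr0_norm // subr_gt0.
apply/eqP; rewrite eq_le; apply/andP; split.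
  by apply: ge_inf => //; exists m.
by apply: lb_le_inf => //; exists m.
Qed.

Lemma maximum_eqP (R : realType) (A : set R) (c : R) :
  c != 0 -> maximum A = c <-> A c /\ ubound A c.
Proof.
move=> c0; split=> [|Ac]; rewrite /maximum.
  by case: xgetP => [y _ Ay <-|_ c00]; [exact: Ay | rewrite -c00 eqxx in c0].
apply: xget_unique => // y [Ay uy].
by apply/eqP; rewrite eq_le Ac.2 ?uy //; exact: Ac.1.
Qed.

(* Main.v *)
Require Import Defs.
From mathcomp Require Import all_boot all_order all_algebra.
From mathcomp Require Import boolp classical_sets reals.
From mathcomp Require Import zify ring lra.
Local Open Scope ring_scope.
Import Order.TTheory GRing.Theory Num.Theory.

(** Write v = 4s + 11, so that the speeds are 8, v - 8, v, v + 8, and let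
    z and y be the fractional parts of 8t and vt. The four positions are then
    z, y - z, y, y + z modulo 1. For unrelated z and y, the four distances to
    the nearest integer can all be at least 1/4 only at the points
    (y, z) = (1/2, 1/4), (1/4, 1/2) and their images under
    (y, z) -> (1 - y, 1 - z), and there the least distance is exactly 1/4.
    The claimed value is 1/4 - e with e = 1 / (16s + 60), so a time beating it
    puts (y, z) in a small triangle around one of these four points.

    But y and z come from the same t, which forces v z - 8 y to be an integer.
    At (1/2, 1/4) this form is v/4 - 4 = s - 5/4, and on the triangle it stays
    within the open interval from s - 2 to s - 1
    ([quarter_triangle_no_integer]; the residue of v modulo 4 matters
    here). At (1/4, 1/2) it is v/2 - 2 = 2s + 7/2, and the
    triangle keeps it strictly between 2s + 3 and 2s + 4, a bound that
    determines the size of e ([half_triangle_no_integer]). Neither open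
    interval contains an integer, which gives the upper bound [some_distZ_le].

    The extreme vertex of the second triangle is attained at the explicit time
    of [lonely_time], which gives the lower bound. *)

Lemma lt_distZ (R : realType) (c x : R) :
  c < distZ x -> exists k : int, c < x - k%:~R < 1 - c.
Proof.
rewrite distZE lt_min intrD => /andP[lo hi].
by exists (Num.floor x); apply/andP; split; lra.
Qed.

Lemma le_distZ (R : realType) (c x : R) (k : int) :
  0 < c -> c <= x - k%:~R <= 1 - c -> c <= distZ x.
Proof.
move=> c_gt0 /andP[lo hi]; rewrite distZE (_ : Num.floor x = k).
  by rewrite le_min intrD; apply/andP; split; lra.
by apply: floor_def; rewrite intrD; apply/andP; split; lra.
Qed.

Lemma no_int_between (R : realFieldType) (m n : int) (x : R) :
  m%:~R < x < (m + 1)%:~R -> x <> n%:~R.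
Proof. by move=> + xn; rewrite {x}xn !ltr_int; lia. Qed.

(** The inequalities cut out a triangle shrinking to (1/2, 1/4) with e. The
    linear form is largest at (1/2, 1/4 + e), with value s - 1 - 4e, and
    smallest at (1/2 + 2e, 1/4 - e), where it still exceeds s - 2. *)
Lemma quarter_triangle_no_integer (R : realFieldType) (s : nat) (e y z : R)
    (n : int) :
  e * (16 * s%:R + 60) = 1 ->
  1 / 4 - e < z -> 1 / 4 - e < y - z -> y + z < 3 / 4 + e ->
  (4 * s%:R + 11) * z - 8 * y <> n%:~R.
Proof.
have := ler0n R s; set S : R := s%:R => S0 eS hz hd hs.
have e0 : 0 < e by rewrite -(@pmulr_lgt0 _ (16 * S + 60)) ?eS //; lra.
have p1 : 0 < (4 * S + 19) * (z - (1 / 4 - e)) by apply: mulr_gt0; lra.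
have p2 : 0 <= S * (3 / 4 + e - (y + z)) by apply: mulr_ge0; lra.
have p3 : 0 <= S * (y - z - (1 / 4 - e)) by apply: mulr_ge0; lra.
have p4 : 0 <= S * e by apply: mulr_ge0; lra.
apply: (@no_int_between R (s%:Z - 2)).
by rewrite !(intrB, intrD) -!pmulrn -/S; apply/andP; split; lra.
Qed.

(** The inequalities cut out a triangle shrinking to (1/4, 1/2) with e. The
    linear form is largest at its vertex (1/4 - e, 1/2 + 2e), with value
    exactly 2s + 4: this vertex is excluded by the strict inequalities, and it
    is the position at the optimal time. *)
Lemma half_triangle_no_integer (R : realFieldType) (s : nat) (e y z : R)
    (n : int) :
  e * (16 * s%:R + 60) = 1 ->
  1 / 4 - e < y -> y + z < 3 / 4 + e -> y - z + 1 < 3 / 4 + e ->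
  (4 * s%:R + 11) * z - 8 * y <> n%:~R.
Proof.
have := ler0n R s; set S : R := s%:R => S0 eS hy hs hd.
have e0 : 0 < e by rewrite -(@pmulr_lgt0 _ (16 * S + 60)) ?eS //; lra.
have p1 : 0 <= S * (y - (1 / 4 - e)) by apply: mulr_ge0; lra.
have p2 : 0 <= S * (3 / 4 + e - (y + z)) by apply: mulr_ge0; lra.
have p3 : 0 <= S * (3 / 4 + e - (y - z + 1)) by apply: mulr_ge0; lra.
have p4 : 0 <= S * e by apply: mulr_ge0; lra.
apply: (@no_int_between R (2 * s%:Z + 3)).
by rewrite !intrD intrM -!pmulrn -/S; apply/andP; split; lra.
Qed.

(** The carry p of y + z and the borrow q of y - z are 0 or 1, and each of the
    four choices selects one of the four triangles. *)
Lemma some_distZ_le (R : realType) (s : nat) (t : R) :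
  let c : R := (2 * s%:R + 7) / (8 * s%:R + 30) in
  c < distZ (t * 8) -> c < distZ (t * (4 * s%:R + 3)) ->
  c < distZ (t * (4 * s%:R + 11)) -> distZ (t * (4 * s%:R + 19)) <= c.
Proof.
move=> c h8 h3 h11; rewrite leNgt; apply/negP => h19; move: h8 h3 h11 h19.
have := ler0n R s; set S : R := s%:R => S0.
pose e : R := (16 * S + 60)^-1.
have eS : e * (16 * S + 60) = 1 by rewrite mulVf //; apply: lt0r_neq0; lra.
have e0 : 0 < e by rewrite invr_gt0; lra.
have e60 : e <= 1 / 60 by have := mulr_ge0 (ltW e0) S0; lra.
have -> : c = 1 / 4 - e.
  by rewrite /c /e -/S; field; apply/andP; split; apply: lt0r_neq0; lra.
move=> {c} /lt_distZ[a /andP[a1 a2]] /lt_distZ[b1 /andP[l1 l2]].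
move=> /lt_distZ[b /andP[b01 b02]] /lt_distZ[b2 /andP[u1 u2]].
pose p := b2 - b - a; pose q := b - b1 - a.
set z := t * 8 - a%:~R in a1 a2.
set y := t * (4 * S + 11) - b%:~R in b01 b02.
have hs : t * (4 * S + 19) - b2%:~R = y + z - p%:~R.
  by rewrite /p /y /z !intrB; ring.
have hd : t * (4 * S + 3) - b1%:~R = y - z + q%:~R.
  by rewrite /q /y /z !intrB; ring.
rewrite {}hs in u1 u2; rewrite {}hd in l1 l2.
pose N := 8 * b - (4 * s%:Z + 11) * a.
have lat : (4 * S + 11) * z - 8 * y = N%:~R.
  by rewrite /N /y /z !(intrB, intrD, intrM) -!pmulrn -/S; ring.
have lat' : (4 * S + 11) * (1 - z) - 8 * (1 - y) = (4 * s%:Z + 3 - N)%:~R.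
  by rewrite intrB -lat !(intrD, intrM) -!pmulrn -/S; ring.
have carry (k : int) : -1 < k%:~R :> R -> k%:~R < 2 :> R -> k = 0 \/ k = 1.
  by rewrite -[-1]/((-1)%:~R) -[2]/(2%:~R) !ltr_int; lia.
have p01 : p = 0 \/ p = 1 by apply: carry; lra.
have q01 : q = 0 \/ q = 1 by apply: carry; lra.
clearbody p q.
case: p01 q01 u1 u2 l1 l2 => -> [] -> u1 u2 l1 l2.
- by apply: (@quarter_triangle_no_integer R s e y z N eS _ _ _ lat); lra.
- by apply: (@half_triangle_no_integer R s e y z N eS _ _ _ lat); lra.
- by apply: (@half_triangle_no_integer R s e _ _ _ eS _ _ _ lat'); lra.
- by apply: (@quarter_triangle_no_integer R s e _ _ _ eS _ _ _ lat'); lra.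
Qed.

(** With D = 8s + 30 = v + (v + 8), the optimum is sought as t = k / D, and the
    vertex (1/4 - e, 1/2 + 2e) asks for k odd with 4k = 2s + 8 modulo D.
    Since 2s + 8 is the inverse of 2 modulo D/2 = 4s + 15, this is solved by
    k = 2 (s + 4)^2 + D/2, for which 4k = (s + 6) D + 2s + 8. The
    integers below are the floors of the four products; the fractional parts
    times D are 4s + 16, 6s + 21, 2s + 7 and 6s + 23, all between 2s + 7 and
    D - (2s + 7) = 6s + 23. *)
Lemma lonely_time (R : realType) (s : nat) :
  let c : R := (2 * s%:R + 7) / (8 * s%:R + 30) in
  exists t : R, [/\ c <= distZ (t * 8), c <= distZ (t * (4 * s%:R + 3)),
    c <= distZ (t * (4 * s%:R + 11)) & c <= distZ (t * (4 * s%:R + 19))].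
Proof.
have := ler0n R s; set S : R := s%:R => S0 c.
pose D := 8 * S + 30.
have D0 : 0 < D by rewrite /D; lra.
have c0 : 0 < c by apply: divr_gt0; lra.
exists ((2 * (S + 4) ^+ 2 + 4 * S + 15) / D).
have bound (k : int) (x r : R) : x - k%:~R = r / D ->
    2 * S + 7 <= r <= 6 * S + 23 -> c <= distZ x.
  move=> xr /andP[r1 r2]; apply: (@le_distZ R c x k c0); rewrite xr.
  have -> : 1 - c = (6 * S + 23) / D by rewrite /c /D; field; apply: lt0r_neq0.
  by rewrite /c -/D !ler_pM2r ?invr_gt0 // r1.
pose j := (s%:Z + 4) ^+ 2 + 2 * s%:Z + 7.
split.
- apply: (bound (2 * s%:Z + 12) _ (4 * S + 16)); last first.
    by apply/andP; split; lra.
  rewrite intrD intrM -!pmulrn -/S /D; field; exact: lt0r_neq0.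
- apply: (bound (j - 3 * s%:Z - 19) _ (6 * S + 21)); last first.
    by apply/andP; split; lra.
  rewrite /j !(intrB, intrD, intrM, rmorphXn) /= ?(intrD, intrM).
  rewrite -!pmulrn -/S /D; field; exact: lt0r_neq0.
- apply: (bound (j - s%:Z - 6) _ (2 * S + 7)); last first.
    by apply/andP; split; lra.
  rewrite /j !(intrB, intrD, intrM, rmorphXn) /= ?(intrD, intrM).
  rewrite -!pmulrn -/S /D; field; exact: lt0r_neq0.
- apply: (bound (j + s%:Z + 6) _ (6 * S + 23)); last first.
    by apply/andP; split; lra.
  rewrite /j !(intrD, intrM, rmorphXn) /= ?(intrD, intrM).
  rewrite -!pmulrn -/S /D; field; exact: lt0r_neq0.
Qed.

Theorem theorem2p2 (R : realType) (s : nat) :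
  ML R [tuple 8; 4 * s + 3; 4 * s + 11; 4 * s + 19]%N
    = (2 * s%:R + 7) / (8 * s%:R + 30)
  /\ (2 * s%:R + 7) / (8 * s%:R + 30)
    = (2 * s%:R + 7) / (4 * (2 * s%:R + 7) + 2) :> R.
Proof.
split; last by congr (_ / _); ring.
have S0 := ler0n R s.
set c := _ / _; set v := [tuple _; _; _; _].
have speeds : [/\ tnth v (inord 0) = 8, tnth v (inord 1) = 4 * s + 3,
    tnth v (inord 2) = 4 * s + 11 & tnth v (inord 3) = 4 * s + 19]%N.
  by split; rewrite (tnth_nth 0%N) inordK.
case: speeds => v0 v1 v2 v3.
have cast k : (4 * s + k)%:R = 4 * s%:R + k%:R :> R by rewrite natrD natrM.
have le_c t : min_distZ v t <= c.
  have min_le k := bigmin_le (distZ (t * (thead v)%:R)) (inord k : 'I_4)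
                             (fun i => distZ (t * (tnth v i)%:R)).
  rewrite leNgt; apply/negP => lt_c.
  have := lt_le_trans lt_c (min_le 3%N); rewrite v3 cast ltNge => /negP; apply.
  by apply: some_distZ_le; apply: lt_le_trans lt_c _; rewrite -?cast;
    [rewrite -v0 | rewrite -v1 | rewrite -v2]; exact: min_le.
apply/maximum_eqP; first by apply: lt0r_neq0; apply: divr_gt0; lra.
split; last by move=> _ [t _ <-].
have [t [d0 d1 d2 d3]] := lonely_time R s; exists t => //.
apply/eqP; rewrite eq_le le_c /=; apply/bigmin_geP; split; first exact: d0.
move=> i _; rewrite (tnth_nth 0%N).
by case: i => -[|[|[|[|//]]]] /= _; rewrite ?cast.
Qed.
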